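(* Let $X$ be a real Banach space. The following are equivalent: (1) $X$ is octahedral. (2) $X_{\mathcal U}$ is $\omega_1$-rigid octahedral for every countably incomplete ultrafilter $\mathcal U$ over any infinite set $I$. (3) $X_{\mathcal U}$ is $\omega_1$-rigid octahedral for every free ultrafilter $\mathcal U$ over $\mathbb N$. (4) $X_{\mathcal U}$ is rigid octahedral for every countably incomplete ultrafilter $\mathcal U$ over any infinite set $I$. (5) $X_{\mathcal U}$ is rigid octahedral for every free ultrafilter $\mathcal U$ over $\mathbb N$.
   Context: $S_E$ is the unit sphere of $E$. For an infinite cardinal $\kappa$, a Banach space $E$ is $\kappa$-octahedral if for every cardinal $\kappa'<\kappa$, every collection $\{x_\alpha:\alpha<\kappa'\}\subseteq S_E$ and every $\varepsilon>0$ there exists $x\in S_E$ such that $\Vert x_\alpha+x\Vert\geq 2-\varepsilon$ for all $\alpha<\kappa'$. It is $\kappa$-rigid octahedral if for every such collection there is $x\in S_E$ with $\Vert x_\alpha+x\Vert=2$ for all $\alpha<\kappa'$. ''(Rigid) octahedral'' without a cardinal means $\omega_0$-(rigid) octahedral. An ultrafilter $\mathcal U$ over $I$ is countably incomplete if there is a sequence $(A_n)$ in $\mathcal U$ with $\bigcap_n A_n=\emptyset$. The ultrapower with respect to a free ultrafilter $\mathcal U$ over $I$ is $X_{\mathcal U}:=\ell_\infty(I,X)/N_{\mathcal U}$, where $\ell_\infty(I,X)$ is the space of bounded functions $f:I\to X$ with the supremum norm and $N_{\mathcal U}=\{f:\lim_{\mathcal U}\Vert f(i)\Vert=0\}$;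 its quotient norm is $\Vert [x_i]_{\mathcal U}\Vert=\lim_{\mathcal U}\Vert x_i\Vert$. *)

(* Defs.v *)
From HB Require Import structures.
From mathcomp Require Import all_boot all_order all_algebra.
From mathcomp Require Import generic_quotient ring_quotient.
From mathcomp Require Import all_classical all_reals all_analysis.
From mathcomp Require Import wochoice.

Set Implicit Arguments.
Unset Strict Implicit.
Unset Printing Implicit Defensive.

Import Order.TTheory GRing.Theory Num.Theory.
Import numFieldNormedType.Exports.

Local Open Scope classical_set_scope.
Local Open Scope card_scope.
Local Open Scope ring_scope.
Local Open Scope quotient_scope.

Definition card_lt (S T : Type) (A : set S) (B : set T) : Prop :=
  A #<= B /\ ~ (B #<= A).

Definition omega0 : set nat := [set: nat].

Definition pow_wo : rel (set nat) := sval (well_ordering_principle (set nat)).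

Definition pow_wo_lt (y x : set nat) : Prop := pow_wo y x /\ y <> x.

(* In a well-order of the uncountable set (set nat), the points with only
   countably many predecessors form the initial segment of order type omega_1;
   card_lt_omega1 identifies its cardinal. *)
Definition omega1 : set (set nat) :=
  [set x | countable [set y | pow_wo_lt y x]].

Section Cardinals.

Lemma card_lt_omega0 (T : Type) (A : set T) : card_lt A omega0 <-> finite_set A.
Proof.
split=> [[_ nle]|Afin].
  by apply: contrapT => /infiniteP.
split; first exact: finite_set_countable.
by move=> /infiniteP; exact.
Qed.

Let pow_woP : well_order pow_wo.
Proof. exact: svalP (well_ordering_principle (set nat)). Qed.

Let wo_min (A : set (set nat)) : A !=set0 ->
  exists2 z, A z & forall y, A y -> pow_wo z y.
Proof.
move=> [x Ax].
have /pow_woP [z [[zA zmin] _]] : nonempty [pred y | y \in A].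
  by exists x; rewrite !inE.
exists z; first by move: zA; rewrite !inE.
by move=> y Ay; apply: zmin; rewrite !inE.
Qed.

Let wo_refl x : pow_wo x x.
Proof. by have [|z -> ] := @wo_min [set x]; [exists x|exact]. Qed.

Let wo_anti x y : pow_wo x y -> pow_wo y x -> x = y.
Proof.
move=> xy yx.
have /pow_woP [z [_ zu]] : nonempty [pred t | (t == x) || (t == y)].
  by exists x; rewrite !inE eqxx.
have <- : z = x.
  apply: zu; split; first by rewrite inE /= eqxx.
  by move=> t; rewrite inE /= => /orP[]/eqP->.
apply: zu; split; first by rewrite inE /= eqxx orbT.
by move=> t; rewrite inE /= => /orP[]/eqP->.
Qed.

Let wf_wo : well_founded pow_wo_lt.
Proof.
move=> x; apply: contrapT => nx.
have [|z nz zmin] := @wo_min [set x | ~ Acc pow_wo_lt x]; first by exists x.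
apply: nz; constructor=> y [yz neq]; apply: contrapT => ny.
by apply: neq; exact/wo_anti/zmin.
Qed.

Let wo_total x y : x <> y -> pow_wo_lt x y \/ pow_wo_lt y x.
Proof.
move=> xy; have [|z] := @wo_min [set x; y]; first by exists x; left.
by move=> [|] -> zmin; [left|right]; split; rewrite /=; auto;
  apply: zmin; [right|left].
Qed.

Lemma omega1_uncountable : ~ countable omega1.
Proof.
move=> ctb.
have [z nz zmin] : exists2 z, (~` omega1) z & forall y, (~` omega1) y -> pow_wo z y.
  apply: wo_min; apply/set0P/eqP => /(congr1 setC); rewrite setCK setC0 => oT.
  move: ctb; rewrite oT => /countable_injP[f fi].
  pose D := [set n | exists2 B : set nat, f B = n & ~ B n].
  case: (pselect (D (f D))) => [DD|nDD]; last by apply: (nDD); exists D.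
  have [B fB nB] := DD; apply: nB.
  by rewrite (fi B D) ?inE.
apply: nz; apply: sub_countable ctb; apply: subset_card_le => y [yz neq].
by apply: contrapT => ny; apply: neq; exact/wo_anti/zmin.
Qed.

Lemma uncountable_ge_omega1 (T : Type) (A : set T) :
  ~ countable A -> omega1 #<= A.
Proof.
move=> uA.
have [t0 At0] : A !=set0.
  by apply/set0P/eqP => A0; apply: uA; rewrite A0; exact: countable0.
pose step x (rec : forall y, pow_wo_lt y x -> T) : T :=
  match pselect (exists t, A t /\ forall y (h : pow_wo_lt y x), rec y h <> t) with
  | left e => sval (cid e)
  | right _ => t0
  end.
pose f := Fix wf_wo (fun _ => T) step.
have fE x : f x = step x (fun y _ => f y).
  rewrite /f Fix_eq // => {}x g h gh; congr step.
  by apply: functional_extensionality_dep => y; apply: functional_extensionality_dep.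
have fP x : omega1 x -> A (f x) /\ forall y, pow_wo_lt y x -> f y <> f x.
  move=> ox; rewrite fE /step; case: pselect => [e|ne].
    by case: cid => t [At tP] /=; split.
  exfalso; apply: ne; apply: contrapT => ne; apply: uA.
  apply: (@sub_countable _ _ _ (f @` [set y | pow_wo_lt y x])); last first.
    exact: sub_countable (card_image_le _ _) ox.
  apply: subset_card_le => t At; apply: contrapT => nt; apply: ne.
  by exists t; split=> // y yx ft; apply: nt; exists y.
have finj : {in omega1 &, injective f}.
  move=> x y; rewrite !inE => ox oy fxy; apply: contrapT => /wo_total[xy|yx].
    by have [_ /(_ _ xy)] := fP _ oy; exact.
  by have [_ /(_ _ yx)] := fP _ ox; apply.
rewrite -(card_le_eql (inj_card_eq finj)).
by apply: subset_card_le => _ [x ox <-]; have [] := fP _ ox.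
Qed.

Lemma card_lt_omega1 (T : Type) (A : set T) : card_lt A omega1 <-> countable A.
Proof.
split=> [[_ nle]|cA].
  by apply: contrapT => /uncountable_ge_omega1.
split; last by move=> /sub_countable/(_ cA)/omega1_uncountable.
apply: card_le_trans cA _; apply/infiniteP.
by move=> /finite_set_countable; exact: omega1_uncountable.
Qed.

End Cardinals.

Section Octahedral.
Context {R : realType}.

Definition unit_sphere (E : normedModType R) : set E := [set x | `|x| = 1].

(* kappa' ranges over the cardinals of the types J; the case kappa' = 0 is
   included. *)
Definition kappa_octahedral (V : Type) (kappa : set V) (E : normedModType R) : Prop :=
  forall J : Type, card_lt [set: J] kappa ->
  forall x_ : J -> E, (forall j, unit_sphere (x_ j)) ->
  forall e : R, 0 < e ->
  exists2 x, unit_sphere x & forall j, 2 - e <= `|x_ j + x|.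

Definition kappa_rigid_octahedral (V : Type) (kappa : set V)
    (E : normedModType R) : Prop :=
  forall J : Type, card_lt [set: J] kappa ->
  forall x_ : J -> E, (forall j, unit_sphere (x_ j)) ->
  exists2 x, unit_sphere x & forall j, `|x_ j + x| = 2.

Definition octahedral (E : normedModType R) : Prop := kappa_octahedral omega0 E.

Definition rigid_octahedral (E : normedModType R) : Prop :=
  kappa_rigid_octahedral omega0 E.

End Octahedral.

Section LInfty.
Context {R : realType} (I : Type) (X : normedModType R).

Definition linfty_pred : {pred I -> X} := [pred f | `[< bounded_fun f >]].

Lemma linfty_predP (f : I -> X) :
  f \in linfty_pred <-> exists M : R, forall i, `|f i| <= M.
Proof.
have -> : (f \in linfty_pred) = `[< bounded_fun f >] by [].
split=> [/asboolP [M [_ Mf]]|[M fM]].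
  by exists (M + 1) => i; apply: (Mf (M + 1) _ i Logic.I); rewrite ltrDl.
apply/asboolP; exists M; split; first exact: num_real.
by move=> x Mx i _; exact: le_trans (fM i) (ltW Mx).
Qed.

Lemma linfty_submod_closed : submod_closed linfty_pred.
Proof.
split; first by apply/linfty_predP; exists 0 => i; rewrite normr0.
move=> a f g /linfty_predP[M fM] /linfty_predP[N gN].
apply/linfty_predP; exists (`|a| * M + N) => i.
rewrite (le_trans (ler_normD _ _))// lerD// normrZ.
exact: ler_wpM2l.
Qed.

HB.instance Definition _ :=
  GRing.isSubmodClosed.Build R (I -> X) linfty_pred linfty_submod_closed.

Record linfty : Type := Linfty {
  linfty_fun :> I -> X;
  linfty_funP : linfty_fun \in linfty_pred }.

HB.instance Definition _ := [isSub for linfty_fun].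
HB.instance Definition _ := [Choice of linfty by <:].
HB.instance Definition _ := [SubChoice_isSubLmodule of linfty by <:].

Implicit Types f g : linfty.

Lemma linfty_bounded f : has_ubound (range (fun i => `|f i|)).
Proof.
by have /linfty_predP[M fM] := linfty_funP f; exists M => _ [i _ <-].
Qed.

Definition linfty_norm f : R := sup (range (fun i => `|f i|)).

Lemma linfty_norm_ge f i : `|f i| <= linfty_norm f.
Proof. by apply: ub_le_sup; [exact: linfty_bounded|exists i]. Qed.

(* 0 <= M is needed only when I is empty *)
Lemma linfty_norm_le f M :
  0 <= M -> (forall i, `|f i| <= M) -> linfty_norm f <= M.
Proof.
move=> M0 fM; rewrite /linfty_norm.
have [->|/set0P ne] := eqVneq (range (fun i => `|f i|)) set0.
  by rewrite sup0.
by apply: ge_sup => // _ [i _ <-].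
Qed.

Lemma linfty_norm_ge0 f : 0 <= linfty_norm f.
Proof.
rewrite /linfty_norm.
have [->|/set0P [_ [i _ _]]] := eqVneq (range (fun i => `|f i|)) set0.
  by rewrite sup0.
exact: le_trans (normr_ge0 (f i)) (linfty_norm_ge f i).
Qed.

Lemma linftyDE f g i : (f + g) i = f i + g i. Proof. by []. Qed.

Lemma linftyNE f i : (- f) i = - f i. Proof. by []. Qed.

Lemma linftyBE f g i : (f - g) i = f i - g i. Proof. by []. Qed.

Lemma linftyZE (a : R) f i : (a *: f) i = a *: f i. Proof. by []. Qed.

Lemma linfty_ext f g : (forall i, f i = g i) -> f = g.
Proof. by move=> fg; apply/val_inj/funext. Qed.

Lemma linfty_ler_normD f g :
  linfty_norm (f + g) <= linfty_norm f + linfty_norm g.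
Proof.
apply: linfty_norm_le => [|i]; first by rewrite addr_ge0 ?linfty_norm_ge0.
by rewrite (le_trans (ler_normD _ _))// lerD// linfty_norm_ge.
Qed.

Lemma linfty_normrZ (a : R) f : linfty_norm (a *: f) = `|a| * linfty_norm f.
Proof.
have le b g : linfty_norm (b *: g) <= `|b| * linfty_norm g.
  apply: linfty_norm_le => [|i]; first by rewrite mulr_ge0 ?linfty_norm_ge0.
  by rewrite linftyZE normrZ ler_wpM2l// linfty_norm_ge.
apply/eqP; rewrite eq_le le/=; have [->|a0] := eqVneq a 0.
  by rewrite normr0 mul0r linfty_norm_ge0.
rewrite -ler_pdivlMl ?normr_gt0// -normfV.
by rewrite -[X in linfty_norm X <= _](scalerK a0) le.
Qed.

Lemma linfty_normr0_eq0 f : linfty_norm f = 0 -> f = 0.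
Proof.
move=> f0; apply: linfty_ext => i; apply/eqP.
by rewrite -normr_le0 -f0 linfty_norm_ge.
Qed.

HB.instance Definition _ := Lmodule_isNormed.Build R linfty
  linfty_ler_normD linfty_normrZ linfty_normr0_eq0.

End LInfty.

(* ler_cvg_to without a topology on the index type *)
Lemma ler_cvg_filter (T : Type) (F : set_system T) {FF : ProperFilter F}
    (R : realFieldType) (f g : T -> R) (l m : R) :
  f @ F --> l -> g @ F --> m -> (forall t, f t <= g t) -> l <= m.
Proof.
move=> fl gm fg; rewrite -subr_ge0.
apply: (cvgr_to_ge (cvgB gm fl)); apply: nearW => t.
by rewrite subr_ge0.
Qed.

(* bundled, so that the structures on the ultrapower are inferred from U *)
Record ultrafilter (I : Type) : Type := Ultrafilter {
  ultrafilter_sets :> set_system I;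
  ultrafilterP : UltraFilter ultrafilter_sets }.

#[export] Existing Instance ultrafilterP.

Definition free_ultrafilter (I : Type) (U : ultrafilter I) : Prop :=
  \bigcap_(A in ultrafilter_sets U) A = set0.

Definition countably_incomplete (I : Type) (U : ultrafilter I) : Prop :=
  exists A : (set I)^nat, (forall n, ultrafilter_sets U (A n)) /\
    \bigcap_n A n = set0.

Lemma countably_incomplete_free (I : Type) (U : ultrafilter I) :
  countably_incomplete U -> free_ultrafilter U.
Proof.
move=> [A [UA A0]]; apply/seteqP; split=> // i Ui.
by rewrite -A0 => n _; exact: Ui.
Qed.

Section Ultrapower.
Context {R : realType} (I : Type) (X : normedModType R) (U : ultrafilter I).

Local Notation linf := (linfty I X).
Local Notation FU := (ultrafilter_sets U).

Definition ultranull : {pred linf} :=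
  [pred f : linf | `[< (fun i => `|f i|) @ FU --> (0 : R) >]].

Lemma ultranullP (f : linf) :
  f \in ultranull <-> (fun i => `|f i|) @ FU --> (0 : R).
Proof. by split=> /asboolP. Qed.

Lemma ultranull_submod_closed : submod_closed ultranull.
Proof.
split.
  apply/ultranullP.
  have -> : (fun i => `|(0 : linf) i|) = cst 0.
    by apply/funext => i; rewrite normr0.
  exact: cvg_cst.
move=> a f g /ultranullP f0 /ultranullP g0; apply/ultranullP.
have h : (fun i => `|a| * `|f i| + `|g i|) @ FU --> (0 : R).
  rewrite -[X in _ --> X](addr0 (0 : R)) -{1}(mulr0 `|a|).
  by apply: cvgD => //; apply: cvgM => //; exact: cvg_cst.
apply: (squeeze_cvgr _ (cvg_cst (0 : R)) h); apply: nearW => i.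
by rewrite normr_ge0 /= (le_trans (ler_normD _ _))// normrZ.
Qed.

HB.instance Definition _ :=
  GRing.isSubmodClosed.Build R linf ultranull ultranull_submod_closed.

Definition ultrapower : Type := Quotient.quot ultranull.

HB.instance Definition _ := Choice.on ultrapower.
HB.instance Definition _ := GRing.Zmodule.on ultrapower.

Definition ultraclass (f : linf) : ultrapower := \pi_(Quotient.quot ultranull) f.

Lemma ultraclass_surj (x : ultrapower) : exists f, ultraclass f = x.
Proof. by exists (repr x); exact: reprK. Qed.

Lemma ultraclass_eq (f g : linf) :
  ultraclass f = ultraclass g <-> f - g \in ultranull.
Proof. by rewrite Quotient.idealrBE; split => /eqP. Qed.

Lemma ultraclassD (f g : linf) :
  ultraclass (f + g) = ultraclass f + ultraclass g.
Proof. exact: Quotient.pi_add. Qed.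

Lemma ultraclass0 : ultraclass 0 = 0.
Proof. by rewrite /ultraclass; rewrite !piE. Qed.

Definition ultrapower_scale (a : R) (x : ultrapower) : ultrapower :=
  ultraclass (a *: repr x).

Lemma ultraclassZ_subproof (a : R) (f : linf) :
  ultraclass (a *: f) = ultrapower_scale a (ultraclass f).
Proof.
apply/ultraclass_eq; rewrite -scalerBr rpredZ//.
by apply/ultraclass_eq; rewrite [RHS]reprK.
Qed.

Let scaleA a b x :
  ultrapower_scale a (ultrapower_scale b x) = ultrapower_scale (a * b) x.
Proof.
have [f <-] := ultraclass_surj x.
by rewrite -!ultraclassZ_subproof scalerA.
Qed.

Let scale1 : left_id 1 ultrapower_scale.
Proof.
move=> x; have [f <-] := ultraclass_surj x.
by rewrite -!ultraclassZ_subproof scale1r.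
Qed.

Let scaleDr : right_distributive ultrapower_scale +%R.
Proof.
move=> a x y; have [f <-] := ultraclass_surj x.
have [g <-] := ultraclass_surj y.
by rewrite -ultraclassD -!ultraclassZ_subproof -ultraclassD scalerDr.
Qed.

Let scaleDl x : {morph ultrapower_scale^~ x : a b / a + b}.
Proof.
move=> a b; have [f <-] := ultraclass_surj x.
by rewrite -!ultraclassZ_subproof -ultraclassD scalerDl.
Qed.

HB.instance Definition _ := GRing.Zmodule_isLmodule.Build R ultrapower
  scaleA scale1 scaleDr scaleDl.

Lemma ultraclassZ (a : R) (f : linf) :
  ultraclass (a *: f) = a *: ultraclass f.
Proof. exact: ultraclassZ_subproof. Qed.

(* the quotient norm induced by the supremum norm *)
Definition ultrapower_norm (x : ultrapower) : R :=
  inf [set `|f| | f in [set f : linf | ultraclass f = x]].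

Lemma ultra_norm_cvg (f : linf) :
  exists L : R, (fun i => `|f i|) @ FU --> L.
Proof.
have FM : ((fun i => `|f i|) @ FU) [set` `[0, `|f|]].
  by apply: nearW => i /=; rewrite in_itv /= normr_ge0; exact: linfty_norm_ge.
have [L [_ cL]] := @segment_compact R 0 `|f| _ _ FM.
exists L => B BL.
have [//|nB] := in_ultra_setVsetC ((fun i => `|f i|) @^-1` B) (ultrafilterP U).
by have [y [/= nBy By]] := cL (~` B) B nB BL.
Qed.

Lemma ultrapower_norm_subproof (f : linf) (L : R) :
  (fun i => `|f i|) @ FU --> L -> ultrapower_norm (ultraclass f) = L.
Proof.
move=> fL.
have L0 : 0 <= L.
  by apply: (cvgr_to_ge fL); apply: nearW => i /=.
have lbL : lbound [set `|g| | g in [set g : linf | ultraclass g = ultraclass f]] L.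
  move=> _ [g /= /esym/ultraclass_eq/ultranullP gf <-].
  have h : (fun i => `|g| + `|(f - g) i|) @ FU --> `|g| + 0.
    by apply: cvgD => //; exact: cvg_cst.
  rewrite -[leRHS]addr0; apply: (ler_cvg_filter fL h) => i.
  rewrite -[X in `|X| <= _](subrK (g i)) addrC (le_trans (ler_normD _ _))//.
  by rewrite lerD2r; exact: linfty_norm_ge.
apply/eqP; rewrite eq_le; apply/andP; split; last first.
  by apply: lb_le_inf => //; exists `|f|, f.
apply/ler_addgt0Pr => e e0.
have [g [gf gL]] : exists g : linf, ultraclass g = ultraclass f /\ `|g| <= L + e.
  pose h i : X := if `|f i| <= L + e then f i else 0.
  have hL i : `|h i| <= L + e.
    by rewrite /h; case: ifP => // _; rewrite normr0 addr_ge0// ltW.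
  have hP : h \in @linfty_pred R I X by apply/linfty_predP; exists (L + e).
  exists (Linfty hP); split; last first.
    by apply: linfty_norm_le => //; rewrite addr_ge0// ltW.
  apply/ultraclass_eq/ultranullP.
  have fLe : \forall i \near FU, `|f i| <= L + e.
    by apply: (cvgr_le _ fL); rewrite ltrDl.
  have h0 : \forall i \near FU, cst (0 : R) i = `|(Linfty hP - f) i|.
    apply: filterS fLe => i fi.
    by rewrite linftyBE /= /h fi subrr normr0.
  exact: cvg_trans (near_eq_cvg h0) (cvg_cst (0 : R)).
apply: le_trans gL; apply: ge_inf; first by exists L.
by exists g.
Qed.

Let ler_normD_ultra x y :
  ultrapower_norm (x + y) <= ultrapower_norm x + ultrapower_norm y.
Proof.
have [f <-] := ultraclass_surj x; have [g <-] := ultraclass_surj y.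
have [F fF] := ultra_norm_cvg f; have [G gG] := ultra_norm_cvg g.
have [H hH] := ultra_norm_cvg (f + g).
rewrite -ultraclassD (ultrapower_norm_subproof fF) (ultrapower_norm_subproof gG).
rewrite (ultrapower_norm_subproof hH).
apply: (ler_cvg_filter hH (cvgD fF gG)) => i.
exact: ler_normD.
Qed.

Let normrZ_ultra (a : R) x :
  ultrapower_norm (a *: x) = `|a| * ultrapower_norm x.
Proof.
have [f <-] := ultraclass_surj x; have [F fF] := ultra_norm_cvg f.
rewrite -ultraclassZ (ultrapower_norm_subproof fF).
apply: ultrapower_norm_subproof.
have -> : (fun i => `|(a *: f) i|) = (fun i => `|a| * `|f i|).
  by apply/funext => i; rewrite -normrZ.
by apply: cvgM => //; exact: cvg_cst.
Qed.

Let normr0_eq0_ultra x : ultrapower_norm x = 0 -> x = 0.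
Proof.
have [f <-] := ultraclass_surj x; have [F fF] := ultra_norm_cvg f.
rewrite (ultrapower_norm_subproof fF) => F0; rewrite F0 in fF.
by rewrite -ultraclass0; apply/ultraclass_eq/ultranullP; rewrite subr0.
Qed.

HB.instance Definition _ := Lmodule_isNormed.Build R ultrapower
  ler_normD_ultra normrZ_ultra normr0_eq0_ultra.

Lemma ultrapower_norm_cvg (f : linf) :
  (fun i => `|f i|) @ FU --> `|ultraclass f|.
Proof.
by have [F fF] := ultra_norm_cvg f; rewrite [`|_|](ultrapower_norm_subproof fF).
Qed.

Lemma ultrapower_normE (f : linf) :
  `|ultraclass f| = lim ((fun i => `|f i|) @ FU).
Proof. by apply/esym/cvg_lim => //; exact: ultrapower_norm_cvg. Qed.

End Ultrapower.

Arguments ultrapower {R I} X U.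

(* Main.v *)
Require Import Defs.
From mathcomp Require Import all_boot all_order all_algebra.
From mathcomp Require Import all_classical all_reals all_analysis.
From mathcomp Require Import lra.

(** Saturation argument.  For (1) => (2), a countably incomplete ultrafilter
    carries a function [N : I -> nat] tending to infinity along it.  Given unit
    vectors [[f_j]], [j < omega], of the ultrapower with [f_j i] normalised,
    octahedrality of [X] yields at each index [i] a unit vector [x i] with
    [`|f_j i + x i| >= 2 - 1 / (N i + 1)] for the finitely many [j <= N i]; the
    class of [x] then works for every [j].  For (5) => (1), embed [X] diagonally
    in the ultrapower by a free ultrafilter on [nat] and read an approximate
    witness off one coordinate. *)

Import Order.TTheory GRing.Theory Num.Theory.
Import numFieldNormedType.Exports.

Local Open Scope classical_set_scope.
Local Open Scope card_scope.
Local Open Scope ring_scope.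

Lemma finite_setT_injP (J : Type) :
  finite_set [set: J] <->
  exists n (f : J -> nat), injective f /\ forall j, (f j < n)%N.
Proof.
split=> [/finite_set_leP[n /card_leP/unsquash f]|[n [f [fi fn]]]].
  exists n, (fun j => set_val (f (SigSub (mem_setT j)))); split=> [j k|j].
    by move=> /val_inj fjk; have -[] := @inj _ _ _ f _ _ (mem_setT _) (mem_setT _) fjk.
  exact: (set_valP (f _)).
apply/finite_set_leP; exists n.
have fJ : {in [set: J] &, injective f} by move=> j k _ _; exact: fi.
rewrite -(card_le_eql (inj_card_eq fJ)).
by apply: subset_card_le => _ [j _ <-]; exact: fn.
Qed.

(** Closure of [F] under finite intersections, transported to ['I_n] along an injection of [J];
    ordinals outside its image impose no condition. *)
Lemma near_forall_finite (T J : Type) (F : set_system T) (P : J -> T -> Prop) :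
  Filter F -> finite_set [set: J] ->
  (forall j, \forall t \near F, P j t) -> \forall t \near F, forall j, P j t.
Proof.
move=> FF /finite_setT_injP[n [f [fi fn]]] FP.
have : \forall t \near F, forall (k : 'I_n) j, f j = k -> P j t.
  apply: filter_forall => k.
  have [[j fj]|nj] := pselect (exists j, f j = k).
    by apply: filterS (FP j) => t Pt j'; rewrite -fj => /fi ->.
  by apply: nearW => t j fj; exfalso; apply: nj; exists j.
by apply: filterS => t Pt j; exact: (Pt (Ordinal (fn j))).
Qed.

(** An ultrafilter refining [\oo] contains every tail, and the tails have empty intersection. *)
Lemma free_ultrafilter_nat : exists U : ultrafilter nat, free_ultrafilter U.
Proof.
have [G [uG leG]] := @ultraFilterLemma nat \oo _.
exists (Ultrafilter uG); apply/seteqP; split=> // n.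
have Gn : G [set m | (n < m)%N] by apply: leG; exact: nbhs_infty_gt.
by move=> /(_ _ Gn) /=; rewrite ltnn.
Qed.

Lemma free_countably_incomplete_nat (U : ultrafilter nat) :
  free_ultrafilter U -> countably_incomplete U.
Proof.
move=> Ufree; exists (fun n => ~` [set n]); split=> [n|]; last first.
  by apply/seteqP; split=> // n /(_ n Logic.I); exact.
(* If the complement of [n] is not in [U], then no member of [U] misses [n], so [n] lies in their
   intersection. *)
apply: contrapT => nU.
have : (set0 : set nat) n; last by [].
rewrite -Ufree => A UA; apply: contrapT => nA; apply: nU.
by apply: filterS UA => m Am /= mn; apply: nA; rewrite -mn.
Qed.

Lemma countably_incomplete_unbounded (I : Type) (U : ultrafilter I) :
  countably_incomplete U ->
  exists N : I -> nat, forall n, \forall i \near ultrafilter_sets U, (n <= N i)%N.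
Proof.
move=> [A [UA A0]].
have ex i : exists n, `[< ~ A n i >].
  apply: contrapT => nex; have : (set0 : set I) i; last by [].
  rewrite -A0 => n _; apply: contrapT => nA; apply: nex; exists n.
  exact/asboolP.
(* [N i] is the first [n] with [i] outside [A n], so [n <= N i] holds on the intersection of the
   first [n] sets. *)
exists (fun i => ex_minn (ex i)) => n.
have : \forall i \near ultrafilter_sets U, forall k : 'I_n, A k i.
  by apply: filter_forall => k; exact: UA.
apply: filterS => i Ai; case: ex_minnP => m /asboolP nAm _.
by rewrite leqNgt; apply/negP => mn; apply: nAm; exact: (Ai (Ordinal mn)).
Qed.

Section Ultrapower.
Context {R : realType}.
Implicit Types X : normedModType R.

(** Radial projection onto the sphere; [z] is the default value at [x = 0]. *)
Lemma unit_sphere_near X (z x : X) : unit_sphere z ->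
  exists2 y, unit_sphere y & `|x - y| = `| `|x| - 1 |.
Proof.
move=> z1; have [->|x0] := eqVneq x 0.
  by exists z => //; rewrite sub0r normr0 sub0r !normrN z1 normr1.
exists (`|x|^-1 *: x).
  by rewrite /unit_sphere /= normrZ normfV normr_id mulVf// normr_eq0.
rewrite -{1}(scale1r x) -scalerBl normrZ -[X in _ * X](normr_id x) -normrM.
by rewrite mulrBl mul1r mulVf// normr_eq0.
Qed.

Lemma octahedral_rigid_omega1 X (I : Type) (U : ultrafilter I) :
  octahedral X -> countably_incomplete U ->
  kappa_rigid_octahedral omega1 (ultrapower X U).
Proof.
move=> octX /countably_incomplete_unbounded[N Nlim] J /card_lt_omega1.
move=> /countable_injP[c cJ] x_ x1.
have cinj : injective c by move=> j k; apply: cJ; rewrite inE.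
(* Octahedrality for the empty family shows that the sphere of [X] is nonempty. *)
have [z z1 _] : exists2 z, unit_sphere z & forall v : void, 2 - 1 <= `|(0 : X) + z|.
  have void0 : card_lt [set: void] omega0.
    by apply/card_lt_omega0/finite_setT_injP; exists 0%N, (fun=> 0%N); split; case.
  have [||z z1 _] := octX void void0 (fun=> 0) _ 1; [by case|exact: ltr01|].
  by exists z => //; case.
have [f fE] : exists f : J -> linfty I X, forall j, ultraclass U (f j) = x_ j.
  by exists (fun j => sval (cid (ultraclass_surj (x_ j)))) => j; case: cid.
have f1 j : (fun i => `|f j i|) @ ultrafilter_sets U --> (1 : R).
  by have := @ultrapower_norm_cvg R I X U (f j); rewrite fE [`|x_ j|]x1.
(* Octahedrality needs unit vectors, so each coordinate is projected to the sphere; by [f1] the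
   error tends to 0 along [U]. *)
have [y yP] : exists y : J -> I -> X, forall j i,
    unit_sphere (y j i) /\ `|f j i - y j i| = `| `|f j i| - 1 |.
  have h j i := unit_sphere_near X z (f j i) z1.
  by exists (fun j i => sval (cid2 (h j i))) => j i; case: cid2.
have xi i : exists2 x, unit_sphere x &
    forall j, (c j <= N i)%N -> 2 - (N i).+1%:R^-1 <= `|y j i + x|.
  have JN : card_lt [set: {j | (c j <= N i)%N}] omega0.
    apply/card_lt_omega0/finite_setT_injP.
    exists (N i).+1, (fun j => c (sval j)); split=> [j k /cinj/val_inj|[]]//.
  have [j||x xx xP] := octX _ JN (fun j => y (sval j) i) _ (N i).+1%:R^-1.
  - by have [] := yP (sval j) i.
  - by rewrite invr_gt0.
  - by exists x => // j jN; exact: (xP (exist _ j jN)).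
pose g i := sval (cid2 (xi i)).
have g1 i : `|g i| = 1 by rewrite /g; case: cid2.
have gP i j : (c j <= N i)%N -> 2 - (N i).+1%:R^-1 <= `|y j i + g i|.
  by rewrite /g; case: cid2 => x _ /= /[apply].
have gb : g \in @linfty_pred R I X by apply/linfty_predP; exists 1 => i; rewrite g1.
pose G := Linfty gb.
have G1 : `|ultraclass U G| = 1.
  rewrite ultrapower_normE; apply: cvg_lim => //.
  by rewrite (_ : (fun i => _) = cst 1); [exact: cvg_cst|exact/funext].
exists (ultraclass U G) => // j.
apply/eqP; rewrite eq_le; apply/andP; split.
  by rewrite (le_trans (ler_normD _ _))// G1 [`|x_ j|]x1.
apply/ler_addgt0Pr => e e0; rewrite -lerBlDr.
rewrite -fE -ultraclassD; apply: (cvgr_to_ge (@ultrapower_norm_cvg R I X U _)).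
(* One half of [e] absorbs the defect [1 / (N i + 1)], the other the distance from [f j i] to
   [y j i]. *)
have e2 : 0 < e / 2 by rewrite divr_gt0.
have [n _ nP] := near_infty_natSinv_lt (PosNum e2).
have f1le : \forall i \near ultrafilter_sets U, `| 1 - `|f j i| | <= e / 2.
  by move/cvgr_dist_le : (f1 j); apply.
near=> i.
have : 2 - (N i).+1%:R^-1 <= `|y j i + g i|.
  by apply: gP; near: i; exact: Nlim.
have : (N i).+1%:R^-1 < e / 2.
  by apply: (nP (N i)) => /=; near: i; exact: Nlim.
have : `|f j i - y j i| <= e / 2 by rewrite (yP j i).2 distrC; near: i.
have : `|y j i + g i| <= `|f j i - y j i| + `|f j i + g i|.
  by rewrite distrC (le_trans _ (ler_normD _ _))// addrA subrK.
rewrite linftyDE -[G i]/(g i).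
have arith (p q r s t : R) :
    p <= q + r -> q <= t / 2 -> s < t / 2 -> 2 - s <= p -> 2 - t <= r by lra.
exact: arith.
Unshelve. all: by end_near. Qed.

Lemma rigid_octahedral_octahedral X (I : Type) (U : ultrafilter I) :
  rigid_octahedral (ultrapower X U) -> octahedral X.
Proof.
move=> rigX J Jfin x_ x1 e e0.
have cb j : cst (x_ j) \in @linfty_pred R I X.
  by apply/linfty_predP; exists `|x_ j|.
pose f j := Linfty (cb j).
have f1 j : unit_sphere (ultraclass U (f j)).
  rewrite /unit_sphere /= ultrapower_normE; apply: cvg_lim => //.
  by rewrite (_ : (fun i => _) = cst 1); [exact: cvg_cst|apply/funext => i; exact: x1].
have [x xx xP] := rigX J Jfin _ f1.
have [g gx] := ultraclass_surj x.
have g1 : (fun i => `|g i|) @ ultrafilter_sets U --> (1 : R).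
  by have := @ultrapower_norm_cvg R I X U g; rewrite gx [`|x|]xx.
(* The bound [e / 2] pays for normalising [g i]; the bound [1 / 2] keeps [g i] nonzero. *)
have e2 : 0 < Num.min (e / 2) (1 / 2) by rewrite lt_min !divr_gt0.
(* Finiteness of [J] lets a single coordinate [i] serve all [j] at once. *)
have gj : \forall i \near ultrafilter_sets U, forall j, 2 - e / 2 <= `|x_ j + g i|.
  apply: near_forall_finite; first exact/card_lt_omega0.
  move=> j; have := @ultrapower_norm_cvg R I X U (f j + g); rewrite ultraclassD gx xP.
  by move=> h; apply: (cvgr_ge _ h); rewrite ltrBlDr ltrDl divr_gt0.
have g1le : \forall i \near ultrafilter_sets U,
    `| 1 - `|g i| | <= Num.min (e / 2) (1 / 2).
  by move/cvgr_dist_le : g1; apply.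
have [i [gi gij]] := filter_ex (filterI g1le gj).
move: gi; rewrite le_min => /andP[gie gi2].
have gi0 : g i != 0.
  by apply/eqP => g0; move: gi2; rewrite g0 normr0 subr0 normr1; lra.
have u1 : unit_sphere (`|g i|^-1 *: g i).
  by rewrite /unit_sphere /= normrZ normfV normr_id mulVf// normr_eq0.
have [y y1 yg] := unit_sphere_near X _ (g i) u1.
exists y => // j; have := gij j.
have : `|x_ j + g i| <= `|x_ j + y| + `|g i - y|.
  by rewrite (le_trans _ (ler_normD _ _))// addrACA subrr addr0.
by move: gie; rewrite yg distrC; lra.
Qed.

End Ultrapower.

Lemma rigid_octahedral_omega1W {R : realType} (E : normedModType R) :
  kappa_rigid_octahedral omega1 E -> rigid_octahedral E.
Proof.
move=> rigE J /card_lt_omega0 Jfin; apply: rigE.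
exact/card_lt_omega1/finite_set_countable.
Qed.

Theorem proposition8p1 (R : realType) (X : completeNormedModType R) :
  [<-> octahedral X;
       forall I : Type, infinite_set [set: I] ->
         forall U : ultrafilter I, countably_incomplete U ->
           kappa_rigid_octahedral omega1 (ultrapower X U);
       forall U : ultrafilter nat, free_ultrafilter U ->
         kappa_rigid_octahedral omega1 (ultrapower X U);
       forall I : Type, infinite_set [set: I] ->
         forall U : ultrafilter I, countably_incomplete U ->
           rigid_octahedral (ultrapower X U);
       forall U : ultrafilter nat, free_ultrafilter U ->
         rigid_octahedral (ultrapower X U) ].
Proof.
have oct_of_free : (forall U : ultrafilter nat, free_ultrafilter U ->
    rigid_octahedral (ultrapower X U)) -> octahedral X.
  have [U freeU] := free_ultrafilter_nat.
  by move=> /(_ _ freeU); exact: rigid_octahedral_octahedral.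
tfae.
- by move=> octX I _ U; exact: octahedral_rigid_omega1.
- move=> h U /free_countably_incomplete_nat; apply: h; exact: infinite_nat.
(* Passing from ultrafilters on [nat] to those on an arbitrary [I] goes back through octahedrality
   of [X]. *)
- move=> h I _ U ciU; apply/rigid_octahedral_omega1W/octahedral_rigid_omega1 => //.
  by apply: oct_of_free => V /h /rigid_octahedral_omega1W.
- move=> h U /free_countably_incomplete_nat; apply: h; exact: infinite_nat.
- exact: oct_of_free.
Qed.
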